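(* Let $R$ be a Mori domain which is not a field, with quotient field $L$. Let $SD(R)$ be the set of nonzero strongly divisorial ideals of $R$, $O_t(R)$ the set of $t$-linked overrings of $R$, and $\phi_R: SD(R)\to O_t(R)\setminus\{L\}$ the map $I\mapsto I^{-1}=(I:I)$. If $\phi_R$ is surjective, then $R$ is an FC-domain.
   Context: An overring of $R$ is a ring $T$ with $R\subseteq T\subseteq L$. For a nonzero fractional ideal $I$ of $R$, $I^{-1}=(R:I)=\{x\in L: xI\subseteq R\}$, $I_v=(I^{-1})^{-1}$, $(I:I)=\{x\in L: xI\subseteq I\}$; $I$ is a $v$-ideal if $I=I_v$. An overring $T$ is $t$-linked over $R$ if, for each finitely generated ideal $I$ of $R$, $I^{-1}=R$ implies $(T:IT)=\{x\in L: xIT\subseteq T\}=T$. A nonzero ideal $I$ of $R$ is strongly divisorial if $I=II^{-1}=I_v$; in that case $I^{-1}=(I:I)$ is a $t$-linked overring of $R$ different from $L$, so $\phi_R$ is well defined. $R$ is Mori if it satisfies the ascending chain condition on $v$-ideals contained in $R$. $R$ is an FC-domain if each chain of distinct overrings of $R$ is finite. *)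

(* Defs.v *)
From HB Require Import structures.
From mathcomp Require Import all_boot all_order all_algebra.
From mathcomp Require Import boolp classical_sets functions cardinality.

Set Implicit Arguments.
Unset Strict Implicit.
Unset Printing Implicit Defensive.

Import GRing.Theory.
Local Open Scope ring_scope.
Local Open Scope classical_set_scope.

(* Rings, ideals and overrings are all subsets of a fixed field L. *)
Section SubsetsOfField.
Variable L : fieldType.
Implicit Types R T I A B : set L.

(* (A : B) *)
Definition colon A B : set L := [set x | forall y, B y -> A (x * y)].

(* The product AB: finite sums of products a * b with a in A and b in B. *)
Definition prodset A B : set L :=
  [set x | exists2 s : seq (L * L),
     (forall p, p \in s -> A p.1 /\ B p.2) & x = \sum_(p <- s) p.1 * p.2].

Definition submodule R I : Prop :=
  [/\ I 0, (forall x y, I x -> I y -> I (x + y))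
    & (forall r x, R r -> I x -> I (r * x))].

Definition ideal R I : Prop := submodule R I /\ I `<=` R.

Definition nonzero I : Prop := exists2 x, I x & x != 0.

Definition fractional_ideal R I : Prop :=
  submodule R I /\ exists d, [/\ R d, d != 0 & forall x, I x -> R (d * x)].

Definition fin_gen_ideal R I : Prop :=
  ideal R I /\ exists s : seq L, I = prodset R [set x | x \in s].

Definition inv_ideal R I : set L := colon R I.

Definition v_closure R I : set L := inv_ideal R (inv_ideal R I).

Definition v_ideal R I : Prop :=
  [/\ fractional_ideal R I, nonzero I & I = v_closure R I].

Definition overring R T : Prop := GRing.subring_closed (mem T) /\ R `<=` T.

Definition t_linked R T : Prop :=
  forall I, fin_gen_ideal R I -> inv_ideal R I = R ->
    colon T (prodset I T) = T.

Definition strongly_divisorial R I : Prop :=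
  [/\ ideal R I, nonzero I, I = prodset I (inv_ideal R I)
    & I = v_closure R I].

Definition SD R : set (set L) := [set I | strongly_divisorial R I].

Definition Ot R : set (set L) := [set T | overring R T /\ t_linked R T].

(* As a function on all subsets; see phi_colon and phi_fun for its restriction
   to SD R. *)
Definition phi R : set L -> set L := fun I => inv_ideal R I.

Definition Mori R : Prop :=
  forall I : nat -> set L,
    (forall n, v_ideal R (I n) /\ I n `<=` R) ->
    (forall n, I n `<=` I n.+1) ->
    exists N, forall n, (N <= n)%N -> I n = I N.

Definition FC_domain R : Prop :=
  forall C : set (set L),
    C `<=` overring R -> total_on C (fun S T => S `<=` T) -> finite_set C.

Lemma mem_prodset A B a b : A a -> B b -> prodset A B (a * b).
Proof.
move=> Aa Bb; exists [:: (a, b)]; last by rewrite big_seq1.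
by move=> p; rewrite inE => /eqP ->.
Qed.

Lemma prodset_sub A B T :
  T 0 -> (forall x y, T x -> T y -> T (x + y)) ->
  (forall a b, A a -> B b -> T (a * b)) -> prodset A B `<=` T.
Proof.
move=> T0 TD TM x [s sP ->]; rewrite big_seq.
by apply: (big_ind (T : L -> Prop)) => // p /sP[]; exact: TM.
Qed.

Lemma phi_colon R I : strongly_divisorial R I -> phi R I = colon I I.
Proof.
move=> [[_ IR] _ IE _]; apply/seteqP; split=> x xI y Iy; last exact/IR/xI.
by rewrite IE mulrC; apply: mem_prodset.
Qed.

Lemma phi_fun R : GRing.subring_closed (mem R) -> R <> setT ->
  set_fun (SD R) (Ot R `\ setT) (phi R).
Proof.
move=> [R1' RB' RM'] RT I SDI.
have R1 : R 1 by exact/set_mem/R1'.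
have RB x y : R x -> R y -> R (x - y).
  by move=> /mem_set xR /mem_set yR; exact/set_mem/RB'.
have RM x y : R x -> R y -> R (x * y).
  by move=> /mem_set xR /mem_set yR; exact/set_mem/RM'.
have R0 : R 0 by rewrite -(subrr 1); exact: RB.
have RD x y : R x -> R y -> R (x + y).
  by move=> Rx Ry; rewrite -[y]opprK -[- y]sub0r; apply: (RB) => //; exact: (RB).
have phiE := phi_colon SDI; have [[[I0 ID IM] IR] [a Ia a0] IE _] := SDI.
have phiR : R `<=` phi R I by rewrite phiE => r Rr x Ix; exact: IM.
split; last first.
  move=> /seteqP[_ phiT]; apply: RT; apply/seteqP; split=> // x _.
  have : phi R I (x / a) by exact: phiT.
  by move=> /(_ _ Ia); rewrite divfK.
have phiM x y : phi R I x -> phi R I y -> phi R I (x * y).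
  by rewrite phiE => xI yI z Iz; rewrite -mulrA; apply/xI/yI.
split; [split=> //; split=> [|x y|x y] |].
- exact/mem_set/phiR.
- move=> /set_mem xI /set_mem yI; apply/mem_set => z Iz.
  by rewrite mulrBl; apply: RB; [exact: xI|exact: yI].
- by move=> /set_mem xI /set_mem yI; apply/mem_set/phiM.
move=> J [[_ sJR] _] JR; apply/seteqP; split=> x xI.
  move=> z; rewrite IE; move: z; apply: (@prodset_sub _ _ [set z | R (x * z)]).
  - by rewrite /= mulr0.
  - by move=> u v /= Ru Rv; rewrite mulrDr; exact: RD.
  move=> u v Iu vI /=; rewrite -[R]JR => j Jj.
  have -> : x * (u * v) * j = x * (j * v) * u.
    by rewrite -!mulrA [u * _]mulrC -mulrA [j * _]mulrCA.
  by apply: (xI (j * v)) => //; exact: mem_prodset.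
apply: (@prodset_sub _ _ [set z | phi R I (x * z)]).
- by rewrite /= mulr0; apply: phiR.
- by move=> u v /= uI vI z Iz; rewrite mulrDr mulrDl; apply: RD;
    [exact: uI|exact: vI].
- move=> u v /sJR Ru vI z Iz /=; rewrite mulrCA -mulrA; apply: (RM) => //.
  exact: (phiM).
Qed.

End SubsetsOfField.

(* The domain R viewed as a subset of its quotient field {fraction R}. *)
Definition in_frac (R : idomainType) : set {fraction R} :=
  range (@FracField.tofrac R).

Arguments in_frac R : clear implicits.

(* Main.v *)
Require Import Defs.
From HB Require Import structures.
From mathcomp Require Import all_boot all_order all_algebra.
From mathcomp Require Import boolp classical_sets functions cardinality.
Import GRing.Theory.
Local Open Scope ring_scope.
Local Open Scope classical_set_scope.

(** Let [s] be a nonzero nonunit of the Mori domain [R].  The localization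
    [R[1/s]] is t-linked, so if it were not [L] it would be [(I : I)] for some
    nonzero ideal [I] of [R]; then every [a] in [I] would be divisible by all
    powers of [s], against the ascending chain condition on principal ideals.
    Hence [R[1/s] = L] for all such [s], i.e. [R] is local of dimension one.
    It follows that [R] is the only finitely generated ideal with inverse [R],
    so every overring is t-linked and, unless it is [L], of the form [R : I].
    The Mori property, applied to conductors [R : T_n] of a descending sequence
    and to multiples [d T_n] of an ascending one, then gives both chain
    conditions on overrings, which makes every chain finite. *)

(** * Finiteness of chains from the two chain conditions *)

Section ChainConditions.
Context {T : Type}.
Implicit Types (C : set T) (r : T -> T -> Prop).

(** Without a least element, totality puts a different element below each one, and choice yields a
    descending sequence with no two consecutive terms equal. *)
Lemma stationary_least C r : total_on C r ->
    (forall f : nat -> T, (forall n, C (f n)) -> (forall n, r (f n.+1) (f n)) ->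
      exists n, f n.+1 = f n) ->
  C !=set0 -> exists2 m, C m & forall x, C x -> r m x.
Proof.
move=> Ctot stat [c Cc]; apply: contrapT => noleast.
have next (x : {x | C x}) :
    exists y : {x | C x}, r (sval y) (sval x) /\ sval y <> sval x.
  apply: contrapT => nonext; apply: noleast; exists (sval x).
    exact: svalP.
  move=> y Cy; have [//|ryx] := Ctot _ _ (svalP x) Cy.
  have [yx|yx] := pselect (y = sval x).
    by have [] := Ctot _ _ (svalP x) Cy; rewrite yx.
  by exfalso; apply: nonext; exists (exist _ y Cy).
have [g gP] := choice next.
pose f n := sval (iter n g (exist _ c Cc)).
have [n|n|n fn] := stat f; [exact: svalP| |].
  by case: (gP (iter n g (exist _ c Cc))).
by case: (gP (iter n g (exist _ c Cc))) => _; apply.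
Qed.

(** Otherwise take the least [m] with infinitely many elements below it, and the greatest [x] among
    those other than [m]. Infinitely many elements lie below [x] too, so [m] is below [x], whence
    [x = m]. *)
Lemma finite_chain C r : total_on C r ->
    (forall x y, r x y -> r y x -> x = y) ->
    (forall f : nat -> T, (forall n, C (f n)) -> (forall n, r (f n) (f n.+1)) ->
      exists n, f n.+1 = f n) ->
    (forall f : nat -> T, (forall n, C (f n)) -> (forall n, r (f n.+1) (f n)) ->
      exists n, f n.+1 = f n) ->
  finite_set C.
Proof.
move=> Ctot anti acc dcc.
have least A : A `<=` C -> A !=set0 -> exists2 m, A m & forall x, A x -> r m x.
  move=> AC; apply: stationary_least => [x y /AC Cx /AC|f Af].
    exact: Ctot.
  by apply: dcc => n; exact/AC.
have greatest A : A `<=` C -> A !=set0 ->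
    exists2 m, A m & forall x, A x -> r x m.
  move=> AC; apply: (@stationary_least _ (fun x y => r y x)).
    by move=> x y /AC Cx /AC Cy; exact: Ctot.
  by move=> f Af; apply: acc => n; exact/AC.
apply: contrapT => Cinf.
have C_neq0 (A : set T) : infinite_set A -> A !=set0.
  by move=> Ainf; apply/set0P/eqP => A0; apply: Ainf; rewrite A0.
pose below x := [set y | C y /\ r y x].
have [M CM Mmax] := greatest C (@subset_refl _ _) (C_neq0 _ Cinf).
have [m [Cm infm] mmin] : exists2 m, C m /\ infinite_set (below m) &
    forall x, C x /\ infinite_set (below x) -> r m x.
  apply: (least [set x | C x /\ infinite_set (below x)]) => [x []//|].
  exists M; split=> // bfin; apply: Cinf; apply: sub_finite_set bfin.
  by move=> x Cx; split=> //; exact: Mmax.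
have inf' := infinite_setD infm (finite_set1 m).
have [x [[Cx rxm] xm] xmax] :=
  greatest (below m `\ m) (fun _ h => h.1.1) (C_neq0 _ inf').
apply: xm; apply: anti => //; apply: mmin; split=> // xfin.
by apply: inf'; apply: sub_finite_set xfin => y ym; split;
  [exact: ym.1.1|exact: xmax].
Qed.

End ChainConditions.

(** * Colons, t-linked overrings and localizations *)

Section Overrings.
Context {L : fieldType}.
Implicit Types A B I R T : set L.

Lemma subring_closed_setP R : GRing.subring_closed (mem R) <->
  [/\ R 1, (forall x y, R x -> R y -> R (x - y))
    & (forall x y, R x -> R y -> R (x * y))].
Proof.
split=> [[R1 RB RM]|[R1 RB RM]]; split.
- exact/set_mem/R1.
- by move=> x y /mem_set Rx /mem_set Ry; exact/set_mem/RB.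
- by move=> x y /mem_set Rx /mem_set Ry; exact/set_mem/RM.
- exact/mem_set.
- by move=> x y /set_mem Rx /set_mem Ry; exact/mem_set/RB.
- by move=> x y /set_mem Rx /set_mem Ry; exact/mem_set/RM.
Qed.

Lemma colonS A B B' : B `<=` B' -> colon A B' `<=` colon A B.
Proof. by move=> BB' x xB' y /BB'; exact: xB'. Qed.

Lemma colonK R B : colon R (colon R (colon R B)) = colon R B.
Proof.
apply/seteqP; split=> x xB y yB; last by rewrite mulrC; exact: yB.
by apply: xB => z /(_ _ yB); rewrite mulrC.
Qed.

Section BaseRing.
Variable R : set L.
Hypothesis R_subring : GRing.subring_closed (mem R).

Let R1 : R 1. Proof. by have /subring_closed_setP[] := R_subring. Qed.

Let RB x y : R x -> R y -> R (x - y).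
Proof. by have /subring_closed_setP[_ + _] := R_subring; apply. Qed.

Let RM x y : R x -> R y -> R (x * y).
Proof. by have /subring_closed_setP[_ _] := R_subring; apply. Qed.

Let R0 : R 0. Proof. by rewrite -(subrr 1); exact: RB. Qed.

Let RD x y : R x -> R y -> R (x + y).
Proof.
by move=> Rx Ry; rewrite -[y]opprK -[- y]sub0r; do 2!apply: (RB) => //.
Qed.

Let RX x n : R x -> R (x ^+ n).
Proof.
by move=> Rx; elim: n => [|n IHn]; rewrite ?expr0// exprS; exact: RM.
Qed.

(** A colon is its own v-closure by [colonK], and inside [R] the denominator 1 serves. *)
Lemma v_ideal_colon B : nonzero (colon R B) -> colon R B `<=` R ->
  v_ideal R (colon R B).
Proof.
move=> nz sub; split=> //; last by rewrite /v_closure /inv_ideal colonK.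
split; last by exists 1; split=> [||x /sub]; rewrite ?oner_neq0 ?mul1r.
split=> [y By|x y xB yB z Bz|r x Rr xB y By].
- by rewrite mul0r.
- by rewrite mulrDl; apply: RD; [exact: xB|exact: yB].
- by rewrite -mulrA; apply: RM => //; exact: xB.
Qed.

Lemma overring_mem T x : overring R T -> R x -> T x.
Proof. by case=> _; apply. Qed.

(** Testing [I] in place of [IT] suffices, since [I] lies in [IT]. Conversely [IT] lies in [T], so
    [T] always multiplies it into [T]. *)
Lemma overring_t_linked T : overring R T ->
    (forall I, fin_gen_ideal R I -> inv_ideal R I = R -> colon T I `<=` T) ->
  t_linked R T.
Proof.
move=> [/subring_closed_setP[T1 TB TM] RT] TP I Ifg IR.
have T0 : T 0 by rewrite -(subrr 1); exact: TB.
have TD x y : T x -> T y -> T (x + y).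
  by move=> Tx Ty; rewrite -[y]opprK -[- y]sub0r; do 2!apply: (TB) => //.
apply/seteqP; split=> [x xIT|x Tx].
  apply: (TP I) => // y Iy; apply: xIT; rewrite -[y]mulr1.
  exact: mem_prodset.
suff IT : prodset I T `<=` T by move=> y /IT; exact: TM.
apply: prodset_sub => // a b Ia Tb; apply: TM => //; apply: RT.
by case: Ifg => -[_ +] _; exact.
Qed.

(** For a subring [R] this is [R[1/s]] if [s] is nonzero, and all of [L] if [s = 0]. *)
Definition localization s : set L := [set x | exists n, R (x * s ^+ n)].

Lemma overring_localization s : R s -> overring R (localization s).
Proof.
move=> Rs; split; last by move=> x Rx; exists 0%N; rewrite expr0 mulr1.
apply/subring_closed_setP; split.
- by exists 0%N; rewrite mulr1.
- move=> x y [n Rx] [m Ry]; exists (n + m)%N; rewrite mulrBl; apply: RB.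
    by rewrite exprD mulrA; apply: RM => //; exact: RX.
  by rewrite addnC exprD mulrA; apply: RM => //; exact: RX.
- move=> x y [n Rx] [m Ry]; exists (n + m)%N.
  by rewrite exprD mulrACA; exact: RM.
Qed.

Lemma mem_gen (g : seq L) x : x \in g -> prodset R [set y | y \in g] x.
Proof. by move=> xg; rewrite -[x]mul1r; exact: mem_prodset. Qed.

Lemma sub_colon_gen (g : seq L) x : (forall y, y \in g -> R (x * y)) ->
  colon R (prodset R [set y | y \in g]) x.
Proof.
move=> xg z; move: z; apply: (@prodset_sub _ _ _ [set z | R (x * z)]).
- by rewrite /= mulr0.
- by move=> u v /= Ru Rv; rewrite mulrDr; exact: RD.
- by move=> u v Ru vg /=; rewrite mulrCA; apply: RM => //; exact: xg.
Qed.

Lemma t_linked_localization s : R s -> t_linked R (localization s).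
Proof.
move=> Rs; apply: overring_t_linked; first exact: overring_localization.
move=> I [_ [g ->]] IR x xI.
(* One power of [s] clears the denominators for all generators at once, so [x * s ^+ n] lies in the
   inverse of [I], which is [R]. *)
have [n xn] : exists n, forall y, y \in g -> R (x * s ^+ n * y).
  have {xI} : forall y, y \in g -> localization s (x * y).
    by move=> y yg; exact/xI/mem_gen.
  elim: g {IR} => [_|z g IHg xg]; first by exists 0%N.
  have [|n xn] := IHg; first by move=> y yg; apply: xg; rewrite inE yg orbT.
  have [m xm] := xg z (mem_head _ _).
  exists (n + m)%N => y; rewrite inE => /predU1P[->|/xn xny].
    rewrite addnC exprD mulrA mulrAC [_ * _ * z]mulrAC.
    by apply: RM => //; exact: RX.
  by rewrite exprD mulrA mulrAC; apply: RM => //; exact: RX.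
by exists n; rewrite -IR; exact: sub_colon_gen.
Qed.

(** * Consequences of the Mori property and of surjectivity *)

Hypothesis R_Mori : Mori R.

Lemma Mori_divisible (a s : L) : R s -> s != 0 -> a != 0 ->
  (forall n, R (a / s ^+ n)) -> R s^-1.
Proof.
move=> Rs s0 a0 Ra.
have sn0 n : s ^+ n != 0 by rewrite expf_neq0.
(* This is the principal ideal generated by [a / s ^+ n], written as a colon so that [v_ideal_colon]
   applies. *)
pose I n := colon R [set s ^+ n / a].
have IE n x : I n x <-> R (x * (s ^+ n / a)).
  by split=> [|Rx _ ->//]; exact.
have aI n : I n (a / s ^+ n) by apply/IE; rewrite mulrA divfK// divff.
have [n|n x|N IN] := R_Mori I.
- have IR : I n `<=` R.
    move=> x /IE Rx; rewrite -[x](@mulfK _ (s ^+ n / a)).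
      by rewrite invf_div; exact: RM.
    by rewrite mulf_eq0 invr_eq0 negb_or sn0 a0.
  split=> //; apply: v_ideal_colon => //; exists (a / s ^+ n); first exact: aI.
  by rewrite mulf_eq0 invr_eq0 negb_or a0 sn0.
- move=> /IE Rx; apply/IE.
  by rewrite exprSr mulrAC mulrA; exact: RM.
- have := aI N.+1; rewrite IN// => /IE.
  by rewrite exprS invfM !mulrA divfK// mulrAC divff// mul1r.
Qed.

Hypothesis phi_surj : set_surj (SD R) (Ot R `\ setT) (phi R).

Lemma localization_setT s : R s -> s != 0 -> ~ R s^-1 -> localization s = setT.
Proof.
move=> Rs s0 sV; apply: contrapT => sT.
have [|I SDI Is] := phi_surj (localization s).
  split=> //; split; [exact: overring_localization|].
  exact: t_linked_localization.
have [[_ IR] [a Ia a0] _ _] := SDI.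
apply: sV; apply: (Mori_divisible a) => // n.
rewrite mulrC; suff : phi R I (s ^+ n)^-1 by apply.
by rewrite Is; exists n; rewrite mulVf ?expf_neq0.
Qed.

Variable s : L.
Hypotheses (Rs : R s) (s_neq0 : s != 0) (s_nonunit : ~ R s^-1).

(* The element [x0] outside [R] is successively multiplied by powers of the
   generators, each as long as possible without falling into [R]. *)
Lemma nonunits_colon (g : seq L) :
    (forall y, y \in g -> R y /\ (R y^-1 -> y = 0)) ->
  exists2 x, ~ R x & forall y, y \in g -> R (x * y).
Proof.
elim: g => [_|z g IHg gP]; first by exists s^-1.
have [|x Rx xg] := IHg; first by move=> y yg; apply: gP; rewrite inE yg orbT.
have [Rz zV] := gP z (mem_head _ _).
(* Zero is allowed as a generator: its inverse is 0 by convention, and it puts no condition on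
   [x]. *)
have [z0|z0] := eqVneq z 0.
  by exists x => // y; rewrite inE => /predU1P[->|/xg//]; rewrite z0 mulr0.
have [n xn] : localization z x.
  by rewrite localization_setT// => /zV/eqP; exact/negP.
have /ex_minnP[m /asboolP xm mmin] : exists n, `[<R (x * z ^+ n)>].
  by exists n; exact/asboolP.
case: m xm mmin => [|m] xm mmin; first by rewrite expr0 mulr1 in xm.
exists (x * z ^+ m) => [xm'|y].
  by have := mmin m; rewrite ltnn => /(_ (asboolT xm')).
rewrite inE => /predU1P[->|/xg xy]; first by rewrite -mulrA -exprSr.
by rewrite mulrAC; apply: RM => //; exact: RX.
Qed.

(** If 1 is not in [I], no nonzero generator is a unit of [R], and [nonunits_colon] gives an element
    outside [R] in the inverse of [I]. *)
Lemma fin_gen_inv_unit I : fin_gen_ideal R I -> inv_ideal R I = R -> I 1.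
Proof.
move=> [[[_ _ IM] IR] [g Ig]] IRR; apply: contrapT => I1.
have gI y : y \in g -> I y by rewrite Ig; exact: mem_gen.
have [|x Rx xg] := nonunits_colon g.
  move=> y yg; split; first exact/IR/gI.
  move=> Ry; apply/eqP; apply: contrapT => /negP y0.
  by apply: I1; rewrite -(mulVf y0); apply: IM => //; exact: gI.
by apply: Rx; rewrite -IRR Ig; exact: sub_colon_gen.
Qed.

Lemma overring_phi T : overring R T -> T <> setT ->
  exists2 I, strongly_divisorial R I & T = colon R I.
Proof.
move=> RT TL; have [|I SDI <-] := phi_surj T; last by exists I.
split=> //; split=> //; apply: overring_t_linked => // I Ifg IR x xI.
by rewrite -[x]mulr1; apply: xI; exact: fin_gen_inv_unit.
Qed.

Lemma overring_dcc (T : nat -> set L) : (forall n, overring R (T n)) ->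
  (forall n, T n.+1 `<=` T n) -> exists n, T n.+1 = T n.
Proof.
move=> RT Tdec.
(* Only [T 0] may be [L] in the remaining case, hence the shifted index. *)
have [[n nT]|noT] := pselect (exists n, T n.+1 = setT).
  by exists n; apply/seteqP; split=> //; rewrite nT.
have {}noT n : exists2 I, strongly_divisorial R I & T n.+1 = colon R I.
  by apply: overring_phi => // nT; apply: noT; exists n.
have TK n : colon R (colon R (T n.+1)) = T n.+1.
  by have [I _ ->] := noT n; rewrite colonK.
(* The conductors ascend, and each contains the nonzero ideal [I] with [T n.+1 = R : I]; by [TK]
   they determine the overrings. *)
have [n|n|N TN] := R_Mori (fun n => colon R (T n.+1)).
- have sub : colon R (T n.+1) `<=` R.
    move=> x xT; rewrite -[x]mulr1; apply: xT.
    exact: (overring_mem (T n.+1)).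
  split=> //; apply: v_ideal_colon => //.
  have [I [_ [a Ia a0] _ _] ->] := noT n; exists a => // x xI.
  by rewrite mulrC; exact: xI.
- exact: colonS.
- by exists N.+1; rewrite -[LHS]TK -[RHS]TK (TN N.+1).
Qed.

Lemma overring_bigcup (T : nat -> set L) : (forall n, overring R (T n)) ->
  (forall n, T n `<=` T n.+1) -> overring R (\bigcup_n T n).
Proof.
move=> RT Tinc.
have Tle n m : (n <= m)%N -> T n `<=` T m.
  by move=> /subnK <-; elim: (m - n)%N => // k IHk x /IHk /Tinc.
have Tmax x y n m : T n x -> T m y -> exists k, T k x /\ T k y.
  move=> Tx Ty; exists (maxn n m).
  by split; [exact: Tle (leq_maxl _ _) _ Tx|exact: Tle (leq_maxr _ _) _ Ty].
split; last by move=> x Rx; exists 0%N => //; exact: overring_mem.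
apply/subring_closed_setP; split.
- by exists 0%N => //; exact: overring_mem.
- move=> x y [n _ Tx] [m _ Ty]; have [k [kx ky]] := Tmax _ _ _ _ Tx Ty.
  by exists k => //; have [/subring_closed_setP[_ + _] _] := RT k; exact.
- move=> x y [n _ Tx] [m _ Ty]; have [k [kx ky]] := Tmax _ _ _ _ Tx Ty.
  by exists k => //; have [/subring_closed_setP[_ _ +] _] := RT k; exact.
Qed.

Lemma overring_setT T : overring R T -> T s^-1 -> T = setT.
Proof.
move=> RT Ts; apply/seteqP; split=> // x _.
have [n xn] : localization s x by rewrite localization_setT.
have [/subring_closed_setP[T1 _ TM] _] := RT.
rewrite -[x](@mulfK _ (s ^+ n)) ?expf_neq0// -exprVn.
apply: (TM); first exact: overring_mem.
by elim: n {xn} => [|n IHn]; rewrite ?expr0// exprS; exact: TM.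
Qed.

Lemma overring_acc (T : nat -> set L) : (forall n, overring R (T n)) ->
  (forall n, T n `<=` T n.+1) -> exists n, T n.+1 = T n.
Proof.
move=> RT Tinc.
have [[n nT]|noT] := pselect (exists n, T n = setT).
  by exists n; apply/seteqP; split=> //; rewrite nT.
have TC n : exists2 I, strongly_divisorial R I & T n = colon R I.
  by apply: overring_phi => // nT; apply: noT; exists n.
(* The union is not [L], since otherwise some [T n] would contain [s^-1] and be [L]. Hence it is
   some [R : I], and [d] in [I] is a common denominator for all [T n]. *)
have [|I [_ [d Id d0] _ _] UI] := overring_phi _ (overring_bigcup _ RT Tinc).
  move=> UT; have [n _ nT] : (\bigcup_n T n) s^-1 by rewrite UT.
  by apply: noT; exists n; exact: overring_setT.
pose J n := [set x | T n (x / d)].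
(* Scaling a colon by [d] gives a colon: [d (R : K) = (R : d^-1 K)]. *)
have JE n : exists B, J n = colon R B.
  have [K _ TK] := TC n; exists [set y | K (d * y)].
  apply/seteqP; split=> x; rewrite /J /= TK => xK y Ky.
    by rewrite -[y](mulKf d0) mulrA; exact: xK.
  by rewrite -mulrA; apply: xK; rewrite /= mulVKf.
have [n|n x|N JN] := R_Mori J.
- have JR : J n `<=` R.
    move=> x Jx; rewrite -[x](divfK d0).
    have : (\bigcup_n T n) (x / d) by exists n.
    by rewrite UI; exact.
  split=> //; have [B JB] := JE n; rewrite JB; apply: v_ideal_colon.
    rewrite -JB; exists d => //; rewrite /J /= divff//.
    exact: (overring_mem (T n)).
  by rewrite -JB.
- exact: Tinc.
- exists N; apply/seteqP; split=> // x Tx.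
  have : J N.+1 (x * d) by rewrite /J /= mulfK.
  by rewrite JN// /J /= mulfK.
Qed.

Lemma Mori_phi_surj_FC_domain : FC_domain R.
Proof.
move=> C CR Ctot; apply: (finite_chain _ _ Ctot) => [A B AB BA|f Cf|f Cf].
- exact/seteqP.
- by apply: overring_acc => n; exact/CR.
- by apply: overring_dcc => n; exact/CR.
Qed.

End BaseRing.
End Overrings.

(** * Passage to the quotient field *)

Lemma subring_in_frac (R : idomainType) :
  GRing.subring_closed (mem (in_frac R)).
Proof.
apply/subring_closed_setP; split.
- by exists 1; rewrite ?rmorph1.
- by move=> _ _ [x _ <-] [y _ <-]; exists (x - y); rewrite ?rmorphB.
- by move=> _ _ [x _ <-] [y _ <-]; exists (x * y); rewrite ?rmorphM.
Qed.

Theorem corollary4p3 (R : idomainType) (R_not_field : ~ GRing.field_axiom R)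
    (R_Mori : Mori (in_frac R))
    (phi_surj : set_surj (SD (in_frac R)) (Ot (in_frac R) `\ setT)
                  (phi (in_frac R))) :
  FC_domain (in_frac R).
Proof.
have [x x0 xU] : exists2 x : R, x != 0 & x \isn't a GRing.unit.
  apply: contrapT => nox; apply: R_not_field => x x0.
  by apply: contrapT => /negP xU; apply: nox; exists x.
apply: (@Mori_phi_surj_FC_domain _ _ (subring_in_frac R) R_Mori phi_surj
  (FracField.tofrac x)).
- by exists x.
- by rewrite tofrac_eq0.
- move=> [y _ yx]; move/negP: xU; apply; apply/unitrPr; exists y.
  by apply/eqP; rewrite -tofrac_eq tofracM tofrac1 yx mulfV// tofrac_eq0.
Qed.
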